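(* Let $\beta_k\in(0,1)$ and $\eta_k,\hat\eta_k>0$ be given parameters, as used in the Halpern-type past-extragradient scheme $$(\mathrm{P})\qquad\begin{cases} z_{k+1}:=\beta_k y_0+(1-\beta_k)y_k-\eta_k Gz_k,\\ y_{k+1}:=\beta_k y_0+(1-\beta_k)y_k-\hat\eta_k Gz_{k+1},\end{cases}\qquad z_0:=y_0.$$ Let $\{(\hat x_k,z_k)\}$ be generated by the scheme $$\begin{cases}\hat x_{k+1}:=z_k-\hat\gamma_k Gz_k,\\ z_{k+1}:=\hat x_{k+1}+\theta_k(\hat x_{k+1}-\hat x_k)+\nu_k(z_k-\hat x_{k+1})+\kappa_k(z_{k-1}-\hat x_k)-\zeta_k(z_{k-2}-\hat x_{k-1}),\end{cases}$$ starting from $z_{-2}=z_{-1}=z_0=\hat x_{-1}=\hat x_0:=y_0$, and using $$\theta_k:=\frac{\beta_k(1-\beta_{k-1})}{\beta_{k-1}},\quad \nu_k:=\frac{\beta_k}{\beta_{k-1}},\quad \hat\gamma_k:=\hat\eta_{k-1}+\frac{\eta_k}{1-\beta_k},\quad \kappa_k:=\frac{\eta_{k-1}(1-\beta_k)}{\hat\gamma_{k-1}},\quad \zeta_k:=\frac{\theta_k\eta_{k-2}}{\hat\gamma_{k-2}},$$ provided that $\hat\eta_{-2}=\hat\eta_{-1}=\hat\eta_0=\eta_{-2}=\eta_{-1}=\eta_0$. Let $y_k:=z_k-\hat\eta_{k-1}Gz_k+\eta_{k-1}Gz_{k-1}$. Then $\{(y_k,z_k)\}$ is identical to the sequence generated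 by the scheme $(\mathrm{P})$ starting from $y_0$.
   Context: $G:\mathbb{R}^p\to\mathbb{R}^p$ is a single-valued operator, and both schemes are methods for solving the equation $Gy^\star=0$. The iteration index is $k=0,1,2,\dots$ and $y_0\in\mathbb{R}^p$ is an initial point.
   Formalization: The boundary values $\hat\eta_{-1}$ and $\eta_{-1}$ are taken to be 0 rather than $\eta_0$: as printed, the first step gives $z_1=y_0-((1-\beta_0)\hat\eta_{-1}+\eta_0)Gy_0$, which differs from (P) unless $Gy_0=0$; also $\beta_{-1}\in(0,1)$ is assumed. *)

(* Defs.v *)
From mathcomp Require Import all_boot all_order all_algebra.
From mathcomp Require Import reals.

Set Implicit Arguments.
Unset Strict Implicit.
Unset Printing Implicit Defensive.

Import Order.TTheory GRing.Theory Num.Theory.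
Local Open Scope ring_scope.

Section Schemes.
Variables (R : realType) (p : nat).
Notation V := 'cV[R]_p.
Variable G : V -> V.

(* Parameters and iterates are indexed by [int], because the accelerated scheme
   refers to the indices -1, -2 (and, through [gammahat], -3). *)
Variables beta eta etahat : int -> R.

(* The pair (y_k, z_k); the new y uses G at the new z. *)
Fixpoint halpern_past_extragradient (y0 : V) (k : nat) : V * V :=
  if k is j.+1 then
    let: (y, z) := halpern_past_extragradient y0 j in
    let a := beta j *: y0 + (1 - beta j) *: y in
    let z' := a - eta j *: G z in
    (a - etahat j *: G z', z')
  else (y0, y0).

Definition theta (k : int) : R := beta k * (1 - beta (k - 1)) / beta (k - 1).

Definition nu (k : int) : R := beta k / beta (k - 1).

Definition gammahat (k : int) : R := etahat (k - 1) + eta k / (1 - beta k).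

Definition kappa (k : int) : R :=
  eta (k - 1) * (1 - beta k) / gammahat (k - 1).

Definition zeta (k : int) : R := theta k * eta (k - 2) / gammahat (k - 2).

Definition nesterov_scheme (y0 : V) (xhat z : int -> V) : Prop :=
  [/\ [/\ z (-2) = y0, z (-1) = y0 & z 0 = y0],
      xhat (-1) = y0 /\ xhat 0 = y0,
      (forall k : int, 0 <= k ->
         xhat (k + 1) = z k - gammahat k *: G (z k))
    & forall k : int, 0 <= k ->
         z (k + 1) = xhat (k + 1)
                     + theta k *: (xhat (k + 1) - xhat k)
                     + nu k *: (z k - xhat (k + 1))
                     + kappa k *: (z (k - 1) - xhat k)
                     - zeta k *: (z (k - 2) - xhat (k - 1))].

(* The values at index -1 must be 0, and not [eta 0]: at k = 0 the kappa- and
   zeta-terms of the accelerated scheme vanish and theta 0 - nu 0 = - beta 0,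
   so its first step is z 1 = y0 - (1 - beta 0) * gammahat 0 *: G y0, which is
   the step y0 - eta 0 *: G y0 of the Halpern scheme only if etahat (-1) = 0
   (or G y0 = 0); y 0 = y0 then requires eta (-1) = 0 (or G y0 = 0). *)
Definition boundary_steps : Prop :=
  [/\ etahat (-2) = eta 0, etahat 0 = eta 0, eta (-2) = eta 0,
      etahat (-1) = 0 & eta (-1) = 0].

End Schemes.

(* Main.v *)
(** The accelerated scheme is the Halpern scheme with the anchor [y0]
    eliminated: solving the [z]-update at step [k] for [beta k *: y0] and
    substituting it into the update at step [k + 1] gives, once the [y]'s are
    written through [z] and [G z], a recursion in [z] alone.  Its coefficients
    match because [theta k = (1 - beta (k - 1)) * nu k] and
    [theta k - nu k = - beta k]. *)

Require Import Defs.
From mathcomp Require Import all_boot all_order all_algebra.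
From mathcomp Require Import reals.
From mathcomp Require Import ring zify.

Import Order.TTheory GRing.Theory Num.Theory.
Local Open Scope ring_scope.

Section AnchorElimination.
Variables (R : realType) (p : nat) (G : 'cV[R]_p -> 'cV[R]_p).
Variables (beta eta etahat : int -> R) (y0 : 'cV[R]_p).
Variables (y z xhat : int -> 'cV[R]_p).
Hypothesis beta01 : forall k : int, -1 <= k -> 0 < beta k < 1.
Hypothesis eta_gt0 : forall k : int, 0 <= k -> 0 < eta k.
Hypothesis etahat_gt0 : forall k : int, 0 <= k -> 0 < etahat k.
Hypothesis bnd : boundary_steps eta etahat.
Hypothesis xz_gen : nesterov_scheme G beta eta etahat y0 xhat z.
Hypothesis y_def : forall k : int, 0 <= k ->
  y k = z k - etahat (k - 1) *: G (z k) + eta (k - 1) *: G (z (k - 1)).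

(** Needed to cancel the denominators of [kappa] and [zeta]. At [k = 0] the first summand is
    [etahat (-1) = 0], and positivity comes from [eta 0 / (1 - beta 0)]. *)
Lemma gammahat_gt0 (k : int) : 0 <= k -> 0 < gammahat beta eta etahat k.
Proof.
move=> k_ge0; have /andP[_ beta_lt1] : 0 < beta k < 1 by apply: beta01; lia.
rewrite /gammahat ltr_wpDl ?divr_gt0 ?eta_gt0 ?subr_gt0 //.
have [->|k_neq0] := eqVneq k 0; first by case: bnd => _ _ _ ->.
by apply/ltW/etahat_gt0; lia.
Qed.

(** The bracket is [gammahat k *: G (z k)] by the [xhat]-update, and [gammahat k] is the denominator
    of [kappa (k + 1)]. *)
Lemma kappa_term (k : int) : 0 <= k ->
  kappa beta eta etahat (k + 1) *: (z k - xhat (k + 1))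
  = (eta k * (1 - beta (k + 1))) *: G (z k).
Proof.
move=> k_ge0; have := gammahat_gt0 k k_ge0; case: xz_gen => _ _ -> // _ g_gt0.
by rewrite subKr scalerA /kappa addrK divfK ?gt_eqF.
Qed.

Lemma zeta_term (k : int) : 0 <= k ->
  zeta beta eta etahat (k + 1) *: (z (k - 1) - xhat k)
  = (theta beta (k + 1) * eta (k - 1)) *: G (z (k - 1)).
Proof.
(* No update produces [xhat 0], so [k = 0] is separate: the left side vanishes as [z (-1) = xhat 0],
   the right one as [eta (-1) = 0]. *)
move=> k_ge0; have [->|k_neq0] := eqVneq k 0.
  case: xz_gen => -[_ zm1 _] [_ x0] _ _; case: bnd => _ _ _ _ em1.
  by rewrite sub0r zm1 x0 subrr scaler0 em1 mulr0 scale0r.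
have k1_ge0 : 0 <= k - 1 by lia.
have := gammahat_gt0 _ k1_ge0; case: xz_gen => _ _ /(_ _ k1_ge0) + _ g_gt0.
rewrite subrK => ->.
have -> : zeta beta eta etahat (k + 1) = theta beta (k + 1) * eta (k - 1)
                                         / gammahat beta eta etahat (k - 1).
  by rewrite /zeta (_ : k + 1 - 2 = k - 1) //; lia.
by rewrite subKr scalerA divfK ?gt_eqF.
Qed.

Lemma y_initial : y 0 = y0.
Proof.
case: xz_gen => -[_ _ z0] _ _ _; case: bnd => _ _ _ ehm1 em1.
by rewrite y_def // sub0r ehm1 em1 !scale0r subr0 addr0.
Qed.

Lemma z_step0 : z 1 = beta 0 *: y0 + (1 - beta 0) *: y 0 - eta 0 *: G (z 0).
Proof.
have /andP[_ b0_lt1] : 0 < beta 0 < 1 by exact: beta01.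
(* [theta 0] and [nu 0] have denominator [beta (-1)]; this is where the bound at index -1 enters. *)
have /andP[bm1_gt0 _] : 0 < beta (-1) < 1 by exact: beta01.
rewrite y_initial.
case: xz_gen => -[zm2 zm1 z0] [xm1 x0] /(_ 0 (lexx _)) x1 /(_ 0 (lexx _)).
case: bnd => _ _ _ ehm1 _.
rewrite !add0r in x1 *; rewrite x0 xm1 zm1 zm2 x1 z0 => ->.
rewrite !subrr !scaler0 subr0 addr0 /theta /nu /gammahat !sub0r ehm1 add0r.
apply/matrixP => i j; rewrite !mxE; field.
by rewrite !gt_eqF // subr_gt0.
Qed.

Lemma z_stepS (k : int) : 0 <= k ->
  z (k + 1) = beta k *: y0 + (1 - beta k) *: y k - eta k *: G (z k) ->
  z (k + 2) = beta (k + 1) *: y0 + (1 - beta (k + 1)) *: y (k + 1)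
              - eta (k + 1) *: G (z (k + 1)).
Proof.
move=> k_ge0; have k1_ge0 : 0 <= k + 1 by lia.
have /andP[bk_gt0 bk_lt1] : 0 < beta k < 1 by apply: beta01; lia.
have /andP[_ bk1_lt1] : 0 < beta (k + 1) < 1 by apply: beta01; lia.
have [bk_neq0 bk'_neq0 bk1'_neq0] :
    [/\ beta k != 0, 1 - beta k != 0 & 1 - beta (k + 1) != 0].
  by split; rewrite gt_eqF ?subr_gt0.
move=> stepk.
(* Step [k] solved for the anchor; the factor [(beta k)^-1] produces the denominators of
   [theta (k + 1)] and [nu (k + 1)]. *)
have anchor : y0 = (beta k)^-1 *: (z (k + 1) - (1 - beta k) *: y k
                                   + eta k *: G (z k)).
  rewrite stepk; apply/matrixP => i j; rewrite !mxE; field.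
  exact: bk_neq0.
have k11 : k + 1 + 1 = k + 2 by lia.
have k12 : k + 1 - 2 = k - 1 by lia.
case: xz_gen => _ _ xS /(_ _ k1_ge0).
rewrite k11 k12 addrK kappa_term // zeta_term //.
rewrite -[k + 2]k11 !xS // => ->.
(* Both sides become linear combinations of [z (k + 1)], [z k] and the values of [G] at [z (k + 1)],
   [z k], [z (k - 1)], compared entrywise. *)
rewrite [in RHS]anchor !y_def // addrK /theta /nu /gammahat !addrK.
apply/matrixP => i j; rewrite !mxE; field.
by rewrite bk_neq0 bk'_neq0 bk1'_neq0.
Qed.

Lemma z_step (k : nat) :
  z (k%:Z + 1) = beta k *: y0 + (1 - beta k) *: y k - eta k *: G (z k).
Proof.
elim: k => [|k IHk]; first by rewrite add0r; exact: z_step0.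
have -> : k.+1%:Z = k%:Z + 1 by lia.
have -> : k%:Z + 1 + 1 = k%:Z + 2 by lia.
exact: z_stepS.
Qed.

End AnchorElimination.

Theorem theorem7 (R : realType) (p : nat) (G : 'cV[R]_p -> 'cV[R]_p)
    (beta eta etahat : int -> R) (y0 : 'cV[R]_p)
    (y z xhat : int -> 'cV[R]_p)
    (beta01 : forall k : int, -1 <= k -> 0 < beta k < 1)
    (eta_gt0 : forall k : int, 0 <= k -> 0 < eta k)
    (etahat_gt0 : forall k : int, 0 <= k -> 0 < etahat k)
    (bnd : boundary_steps eta etahat)
    (xz_gen : nesterov_scheme G beta eta etahat y0 xhat z)
    (y_def : forall k : int, 0 <= k ->
       y k = z k - etahat (k - 1) *: G (z k) + eta (k - 1) *: G (z (k - 1))) :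
  forall k : nat,
    (y k%:Z, z k%:Z) = halpern_past_extragradient G beta eta etahat y0 k.
Proof.
elim=> [|k IHk].
  have -> : y 0 = y0 by exact: (@y_initial R p G beta eta etahat y0 y z xhat).
  by case: xz_gen => -[_ _ ->].
rewrite /= -IHk (_ : k.+1%:Z = k%:Z + 1); last by lia.
rewrite y_def; last by lia.
have zk := @z_step R p G beta eta etahat y0 y z xhat beta01 eta_gt0
  etahat_gt0 bnd xz_gen y_def k.
(* Adding [eta k *: G (z k)] to [z (k + 1)] recovers the average
   [beta k *: y0 + (1 - beta k) *: y k] from which the Halpern scheme forms its new [y]. *)
by rewrite addrK -zk; congr (_, _); rewrite addrAC {1}zk subrK.
Qed.
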